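(* Let $E$ be a lattice-normed module over a Stone algebra $\mathbb{A}$. Then a subset $M\subseteq E$ has property (CP) if and only if it is uniformly totally order-bounded.
   Context: A Stone algebra is a commutative unital $C^*$-algebra $\mathbb{A}$ (unit $\mathbf{1}$) that is Dedekind complete as a Banach lattice; equivalently $\mathbb{A}\cong \mathrm{C}(\Omega)$ with $\Omega$ compact Hausdorff and extremally disconnected. $\mathbb{A}_+$ is its positive cone. A lattice-normed module over $\mathbb{A}$ is an $\mathbb{A}$-module $E$ (a complex vector space with bilinear multiplication $\mathbb{A}\times E\to E$) together with a map $|\cdot|\colon E\to\mathbb{A}_+$ satisfying $|x|=0\Leftrightarrow x=0$, $|x+y|\le|x|+|y|$ and $|\lambda x|=|\lambda||x|$ for $x,y\in E$, $\lambda\in\mathbb{A}$. For real $\varepsilon>0$ put $\mathrm{B}_E[0;\varepsilon]=\{x\in E\mid |x|\le\varepsilon\mathbf{1}\}$. For a finite set $F\subseteq E$ the $\mathbb{A}$-zonotope determined by $F$ is $$\mathrm{Z}_F:=\Bigl\{\sum_{y\in F}\lambda_y y \;\Big|\; \lambda\in\mathbb{A}^F,\ \sup_{y\in F}|\lambda_y|\le\mathbf{1}\Bigr\}.$$ $M\subseteq E$ has property (CP) if for each real $\varepsilon>0$ there is a finite set $F\subseteq E$ such that $M\subseteq\mathrm{Z}_F+\mathrm{B}_E[0;\varepsilon]$. $M\subseteq E$ is uniformly totally order-bounded if for every real $\varepsilon>0$ there is a finite set $F\subseteq E$ with $\inf_{y\in F}|x-y|\le\varepsilon\mathbf{1}$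 for every $x\in M$. *)

(* Defs.v *)
From HB Require Import structures.
From mathcomp Require Import all_boot all_order all_algebra finmap.
From mathcomp Require Import complex.
From mathcomp Require Import all_classical all_reals topology normedtype.

Set Implicit Arguments.
Unset Strict Implicit.
Unset Printing Implicit Defensive.

Import Order.TTheory GRing.Theory Num.Theory.
Import numFieldNormedType.Exports.

Local Open Scope classical_set_scope.
Local Open Scope ring_scope.

(* MathComp's hierarchy has no join of a ring and a normed module, so the product
   is declared on top of the Banach space structure; [cring] below is A as a
   ring. 1 = 0 is allowed: it is the case of an empty spectrum. *)
HB.mixin Record isCommutativeCStar (R : realType) A
    of CompleteNormedModule R[i] A := {
  c1 : A ;
  cmul : A -> A -> A ;
  cstar : A -> A ;
  cmulA : associative cmul ;
  cmulC : commutative cmul ;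
  cmul1 : left_id c1 cmul ;
  cmulDl : left_distributive cmul +%R ;
  cmulZl : forall (k : R[i]) (a b : A), cmul (k *: a) b = k *: cmul a b ;
  cstarK : involutive cstar ;
  cstarD : forall a b : A, cstar (a + b) = cstar a + cstar b ;
  cstarZ : forall (k : R[i]) (a : A), cstar (k *: a) = k^* *: cstar a ;
  cstarM : forall a b : A, cstar (cmul a b) = cmul (cstar b) (cstar a) ;
  cnormM_le : forall a b : A, `|cmul a b| <= `|a| * `|b| ;
  cnorm_cstar : forall a : A, `|cmul (cstar a) a| = `|a| ^+ 2
}.

#[short(type="comCStarAlgType")]
HB.structure Definition CommutativeCStar (R : realType) :=
  {A of isCommutativeCStar R A & CompleteNormedModule R[i] A}.

Definition cring (R : realType) (A : comCStarAlgType R) : Type := A.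

HB.instance Definition _ (R : realType) (A : comCStarAlgType R) :=
  GRing.Zmodule.copy (cring A) A.
HB.instance Definition _ (R : realType) (A : comCStarAlgType R) :=
  GRing.Zmodule_isComPzRing.Build (cring A)
    (@cmulA R A) (@cmulC R A) (@cmul1 R A) (@cmulDl R A).

(* The order of a C*-algebra, with positive cone { c^* c }. *)
Definition cle (R : realType) (A : comCStarAlgType R) (a b : A) : Prop :=
  exists c : A, b - a = cmul (cstar c) c.

Definition cupper (R : realType) (A : comCStarAlgType R) (S : set A) : set A :=
  [set u | forall a, S a -> cle a u].

Definition clower (R : realType) (A : comCStarAlgType R) (S : set A) : set A :=
  [set v | forall a, S a -> cle v a].

Definition is_csup (R : realType) (A : comCStarAlgType R) (S : set A) (s : A) :=
  cupper S s /\ forall u, cupper S u -> cle s u.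

Definition is_cinf (R : realType) (A : comCStarAlgType R) (S : set A) (s : A) :=
  clower S s /\ forall v, clower S v -> cle v s.

(* The modulus of the complex Banach lattice A, i.e. the unique positive square
   root of a^* a (the pointwise modulus in C(Omega)). *)
Definition cmod (R : realType) (A : comCStarAlgType R) (a : A) : A :=
  xget 0 [set b : A | cle 0 b /\ cmul b b = cmul (cstar a) a].

(* Dedekind completeness concerns the real Banach lattice of self-adjoint
   elements. *)
HB.mixin Record isDedekindComplete (R : realType) A
    of CommutativeCStar R A := {
  dedekind_complete : forall S : set A,
    (forall a, S a -> cstar a = a) -> S !=set0 -> cupper S !=set0 ->
    exists s, is_csup S s
}.

#[short(type="stoneAlgType")]
HB.structure Definition StoneAlgebra (R : realType) :=
  {A of isDedekindComplete R A & CommutativeCStar R A}.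

(* The complex vector space structure of E is the induced one, k x = (k 1) x:
   bilinearity of the multiplication A x E -> E leaves no other choice. *)
HB.mixin Record isLatticeNormed (R : realType) (A : stoneAlgType R) E
    of GRing.Lmodule (cring A) E := {
  lnorm : E -> A ;
  lnorm_ge0 : forall x : E, cle 0 (lnorm x) ;
  lnorm_eq0 : forall x : E, lnorm x = 0 <-> x = 0 ;
  ler_lnormD : forall x y : E, cle (lnorm (x + y)) (lnorm x + lnorm y) ;
  lnormZ : forall (l : cring A) (x : E), lnorm (l *: x) = cmul (cmod l) (lnorm x)
}.

#[short(type="latticeNormedModType")]
HB.structure Definition LatticeNormedModule (R : realType)
    (A : stoneAlgType R) :=
  {E of isLatticeNormed R A E & GRing.Lmodule (cring A) E}.

Section LatticeNormedModuleNotions.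
Context (R : realType) (A : stoneAlgType R) (E : latticeNormedModType A).

Definition cscalar (e : R) : A := (real_complex R e : R[i]) *: (c1 : A).

Definition lball (e : R) : set E := [set x | cle (lnorm x) (cscalar e)].

(* Adjoining 0 gives the supremum in the positive cone; it only matters for F
   empty, where the supremum is 0 and the zonotope is {0}. *)
Definition zonotope (F : {fset E}) : set E :=
  [set x | exists l : E -> cring A,
     (exists2 s : A,
        is_csup (0 |` [set cmod (l y) | y in [set` F]]) s & cle s c1) /\
     x = \sum_(y <- F) l y *: y].

Definition propertyCP (M : set E) : Prop :=
  forall e : R, 0 < e -> exists F : {fset E},
    M `<=` [set z + b | z in zonotope F & b in lball e].

(* For F empty there is no infimum (unless A = 0), so the bound fails. *)
Definition uniformly_totally_order_bounded (M : set E) : Prop :=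
  forall e : R, 0 < e -> exists F : {fset E}, forall x, M x ->
    exists2 g : A,
      is_cinf [set lnorm (x - y) | y in [set` F]] g & cle g (cscalar e).

End LatticeNormedModuleNotions.

(* Main.v *)
(** Both directions avoid Gelfand duality: all computations take place in the
    algebra, whose order is governed by squares of self-adjoint elements and the
    criterion [h >= 0 <-> `|t - h| <= t].

    If [inf_y |x - y| <= e / 2], put [p_y = (e - |x - y|)^+] and [S = \sum_y p_y].
    Then [e - S] is a lower bound of the [|x - y|], so [S >= e / 2] is invertible,
    and the weights [p_y / S] exhibit [x] as a convex combination of the [y] up
    to an error of at most [e].

    Conversely, a zonotope is a finite Minkowski sum of segments
    [{a z | 0 <= a <= 1}] and points, and the order-precompactness of a segment
    follows from Bernstein weights: a lower bound [v] of all [|a - k/n| |z|] is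
    below their weighted mean, which the variance [a (1 - a) / n] of the
    binomial distribution makes small. *)

From HB Require Import structures.
Require Import Defs.
From mathcomp Require Import all_boot all_order all_algebra finmap.
From mathcomp Require Import complex ring lra.
From mathcomp Require Import all_classical all_reals topology normedtype sequences.

Set Implicit Arguments.
Unset Strict Implicit.
Unset Printing Implicit Defensive.

Import Order.TTheory GRing.Theory Num.Theory.
Import numFieldNormedType.Exports.

Local Open Scope classical_set_scope.
Local Open Scope ring_scope.

(** * Commutative C*-algebras *)

Section CStar.
Context (R : realType) (A : comCStarAlgType R).
Local Notation B := (cring A).
Implicit Types (a b c h k x y : B) (s t : R).

Definition star (a : B) : B := cstar (a : A).
Definition nrm (a : B) : R := complex.Re `|a : A|.
Definition sc (t : R) : B := (real_complex R t : R[i]) *: (c1 : A).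
Definition im1 : B := ('i%C : R[i]) *: (c1 : A).

Lemma scale1M (z : R[i]) (a : A) : z *: a = cmul (z *: (c1 : A)) a.
Proof. by rewrite cmulZl cmul1. Qed.

Lemma sc_is_zmod_morphism : zmod_morphism sc.
Proof. by move=> s t; rewrite /sc rmorphB scalerBl. Qed.

Lemma sc_is_monoid_morphism : monoid_morphism sc.
Proof.
split=> [|s t]; first by rewrite /sc rmorph1 scale1r.
by rewrite /sc rmorphM -scalerA scale1M.
Qed.

HB.instance Definition _ := GRing.isZmodMorphism.Build R B sc sc_is_zmod_morphism.
HB.instance Definition _ := GRing.isMonoidMorphism.Build R B sc sc_is_monoid_morphism.

Lemma starK : involutive star. Proof. exact: cstarK. Qed.
Lemma starD a b : star (a + b) = star a + star b. Proof. exact: cstarD. Qed.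
Lemma starM a b : star (a * b) = star a * star b.
Proof. by rewrite [RHS]mulrC; apply: cstarM. Qed.
Lemma star1 : star 1 = 1.
Proof. by rewrite -[LHS]mul1r -[X in X * _]starK -starM mulr1 starK. Qed.
Lemma starZ (z : R[i]) a : star (z *: (a : A)) = (z^* *: (star a : A)).
Proof. exact: cstarZ. Qed.
Lemma star_sc t : star (sc t) = sc t.
Proof.
rewrite /sc starZ [X in _ *: X]star1; congr (_ *: _).
by apply/eqP; rewrite eq_complex /= oppr0 !eqxx.
Qed.
Lemma star_im1 : star im1 = - im1.
Proof.
rewrite /im1 starZ [X in _ *: X]star1; rewrite -scaleNr; congr (_ *: _).
by apply/eqP; rewrite eq_complex /= oppr0 !eqxx.
Qed.
Lemma star0 : star 0 = 0.
Proof. by rewrite -(rmorph0 sc) star_sc. Qed.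
Lemma starN a : star (- a) = - star a.
Proof. by apply/eqP; rewrite -addr_eq0 -starD addNr star0. Qed.
Lemma starB a b : star (a - b) = star a - star b.
Proof. by rewrite starD starN. Qed.
Lemma im1M : im1 * im1 = -1.
Proof.
rewrite -[LHS]/(cmul _ _) /im1 -scale1M scalerA -[-1]/(- c1 : A) -scaleN1r.
by congr (_ *: _); apply/eqP; rewrite eq_complex /=; apply/andP; split; apply/eqP; ring.
Qed.

Lemma nrmE a : `|a : A| = (nrm a)%:C%C.
Proof.
rewrite /nrm; have := normr_ge0 (a : A); case: (`|_|) => u v /=.
by rewrite lecE /= => /andP[/eqP-> _].
Qed.

Lemma nrm_ge0 a : 0 <= nrm a.
Proof. by have := normr_ge0 (a : A); rewrite nrmE lecR. Qed.
Lemma nrmD a b : nrm (a + b) <= nrm a + nrm b.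
Proof. by have := ler_normD (a : A) b; rewrite !nrmE -rmorphD lecR. Qed.
Lemma nrmN a : nrm (- a) = nrm a.
Proof. by rewrite /nrm [X in complex.Re X]normrN. Qed.
Lemma nrmB a b : nrm (a - b) <= nrm a + nrm b.
Proof. by rewrite -(nrmN b) nrmD. Qed.
Lemma nrmM a b : nrm (a * b) <= nrm a * nrm b.
Proof. by have := cnormM_le (a : A) b; rewrite !nrmE -rmorphM lecR. Qed.
Lemma nrm0_eq0 a : nrm a = 0 -> a = 0.
Proof. by move=> a0; apply: (@normr0_eq0 _ A); rewrite nrmE a0. Qed.
Lemma nrm0 : nrm 0 = 0.
Proof. by rewrite /nrm [X in complex.Re X]normr0. Qed.
Lemma nrm_starM a : nrm (star a * a) = nrm a ^+ 2.
Proof.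
have := cnorm_cstar (a : A); rewrite -[cmul _ _]/(star a * a : A) !nrmE -rmorphXn.
by case.
Qed.
Lemma nrmZ t a : nrm (sc t * a) = `|t| * nrm a.
Proof.
rewrite -[sc t * a]/(cmul (_ *: c1) _ : A) -scale1M /nrm [X in complex.Re X]normrZ nrmE.
by rewrite normc_def /= expr0n addr0 sqrtr_sqr mul0r subr0.
Qed.
Lemma nrm_star a : nrm (star a) = nrm a.
Proof.
have le b : nrm b <= nrm (star b).
  have [->|b0] := eqVneq (nrm b) 0; first exact: nrm_ge0.
  have := nrmM (star b) b; rewrite nrm_starM expr2 ler_pM2r //.
  by rewrite lt0r b0 nrm_ge0.
by apply/le_anti; rewrite le [nrm _ <= _](le_trans (le _)) // starK.
Qed.
Lemma nrm_sq a : star a = a -> nrm (a * a) = nrm a ^+ 2.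
Proof. by move=> sa; rewrite -{1}sa nrm_starM. Qed.
(** The C*-identity makes [nrm 1] idempotent, hence 0 or 1; the value 0 is that of the zero
    algebra. *)
Lemma nrm1_le1 : nrm 1 <= 1.
Proof.
have := nrm_sq star1; rewrite mulr1 expr2 => /eqP; rewrite -subr_eq0 -{1}[nrm 1]mulr1 -mulrBr mulf_eq0.
by move=> /orP[/eqP->//|]; rewrite subr_eq0 => /eqP <-.
Qed.
Lemma nrm_sc t : 0 <= t -> nrm (sc t) <= t.
Proof.
by move=> t0; rewrite -[sc t]mulr1 nrmZ ger0_norm // ler_piMr // nrm1_le1.
Qed.
Lemma nrm_small a : (forall e : R, 0 < e -> nrm a <= e) -> a = 0.
Proof.
move=> small; apply: nrm0_eq0; apply/le_anti; rewrite nrm_ge0 andbT.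
by apply/ler_addgt0Pr => e e0; rewrite add0r small.
Qed.
Lemma sa_sqr_eq0 a : star a = a -> a * a = 0 -> a = 0.
Proof.
by move=> /nrm_sq + a0; rewrite a0 nrm0 => /esym/eqP; rewrite sqrf_eq0 => /eqP/nrm0_eq0.
Qed.

(* The scalar sequence [s] dominates the increments of [y], which is therefore
   Cauchy; the bound on [s] passes to the limit. *)
Lemma dominated_seq_cvg (y : nat -> B) (s : nat -> R) (M : R) :
  y 0%N = 0 -> s 0%N = 0 ->
  (forall n, nrm (y n.+1 - y n) <= s n.+1 - s n) -> (forall n, s n <= M) ->
  exists2 l : B, nrm l <= M &
    forall e : R, 0 < e -> exists N, forall n, (N <= n)%N -> nrm (l - y n) < e.
Proof.
move=> y0 s0 dom bs.
have dist m n : (n <= m)%N -> nrm (y m - y n) <= s m - s n.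
  elim: m => [|m IH]; first by rewrite leqn0 => /eqP->; rewrite !subrr nrm0.
  rewrite leq_eqVlt => /orP[/eqP->|]; first by rewrite !subrr nrm0.
  rewrite ltnS => /IH le; rewrite -(subrKA (y m)) -(subrKA (s m)).
  by rewrite (le_trans (nrmD _ _)) // lerD.
have nds : nondecreasing_seq s.
  by move=> n m nm; rewrite -subr_ge0 (le_trans (nrm_ge0 _) (dist _ _ nm)).
have cs : cvgn s.
  by apply: nondecreasing_is_cvgn => //; exists M => _ [n _ <-].
have tail (e : R) : 0 < e -> exists N, forall n, (N <= n)%N -> nrm (y n - y N) < e.
  move=> e0; have /cvgrPdist_lt/(_ e e0)[N _ HN] := cs.
  exists N => n Nn; apply: le_lt_trans (dist _ _ Nn) _.
  apply: le_lt_trans (HN N (leqnn N)); rewrite ger0_norm ?subr_ge0.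
    by rewrite lerD2r nondecreasing_cvgn_le.
  exact: nondecreasing_cvgn_le.
have posE (e : R[i]) : 0 < e -> e = (complex.Re e)%:C%C.
  by case: e => u v; rewrite ltcE /= => /andP[/eqP-> _].
have cy : cvg ((y : nat -> A) @ \oo).
  apply: cauchy_cvg; apply: cauchy_exP => e e0.
  have /tail[N HN] : 0 < complex.Re e by move: (e0); rewrite {1}(posE _ e0) ltcR.
  exists (y N); exists N => // n /= /HN yn; rewrite -ball_normE /=.
  by rewrite distrC (posE _ e0) nrmE ltcR.
have {}cy (e : R) : 0 < e -> exists N, forall n, (N <= n)%N ->
    nrm (lim ((y : nat -> A) @ \oo) - y n) < e.
  move=> e0; have /cvgrPdist_lt/(_ (e%:C%C))[|N _ HN] := cy; first by rewrite ltcR.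
  by exists N => n /HN /=; rewrite nrmE ltcR.
exists (lim ((y : nat -> A) @ \oo)) => //.
apply/ler_addgt0Pr => e /cy[N /(_ N (leqnn N))/ltW HN].
rewrite -[X in nrm X](subrK (y N)) (le_trans (nrmD _ _)) // addrC lerD //.
by have := dist N 0%N isT; rewrite y0 s0 !subr0 => /le_trans; apply.
Qed.

(** Picard iteration from 0, majorised by a scalar iteration. Convergence comes from the majorant,
    so [L] need not be below 1: the Lipschitz bound only carries the equation to the limit.
    Self-adjointness passes to the limit because [star] is isometric. *)
Lemma dominated_fixpoint (phi : B -> B) (psi : R -> R) (L M : R) :
  0 <= L ->
  (forall n, nrm (iter n.+1 phi 0 - iter n phi 0) <= iter n.+1 psi 0 - iter n psi 0) ->
  (forall n, iter n psi 0 <= M) ->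
  (forall a b, nrm a <= M -> nrm b <= M -> nrm (phi a - phi b) <= L * nrm (a - b)) ->
  (forall a, star a = a -> star (phi a) = phi a) ->
  exists l, [/\ nrm l <= M, star l = l & phi l = l].
Proof.
move=> L0 dom bs lip sphi.
have [//|//|l lM cvl] := @dominated_seq_cvg (fun n => iter n phi 0) (fun n => iter n psi 0) M _ _ dom bs.
have yM n : nrm (iter n phi 0) <= M.
  apply: le_trans (bs n); elim: n => [|n IH]; first by rewrite nrm0.
  by rewrite -[X in nrm X](subrK (iter n phi 0)) (le_trans (nrmD _ _)) //
     -[leRHS](subrK (iter n psi 0)) lerD.
have sy n : star (iter n phi 0) = iter n phi 0.
  by elim: n => [|n /sphi//]; rewrite star0.
exists l; split=> //; apply/eqP; rewrite -subr_eq0; apply/eqP/nrm_small => e e0.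
  have [N /(_ N (leqnn N))/ltW HN] := cvl (e / 2) (divr_gt0 e0 (ltr0Sn _ 1)).
  have -> : star l - l = star (l - iter N phi 0) - (l - iter N phi 0).
    by rewrite starB sy opprB addrA subrK.
  by rewrite (le_trans (nrmB _ _)) // nrm_star; lra.
have L1 : 0 < L + 1 by lra.
(* With this tolerance the errors of iterates [N] and [N.+1] contribute [L * e / (L + 1)] and
   [e / (L + 1)], in total [e]. *)
have [N HN] := cvl (e / (L + 1)) (divr_gt0 e0 L1).
have [/ltW h1 /ltW h2] := (HN N (leqnn N), HN N.+1 (leqnSn N)).
have -> : phi l - l = (phi l - phi (iter N phi 0)) - (l - iter N.+1 phi 0).
  by rewrite /= opprB addrA subrK.
rewrite (le_trans (nrmB _ _)) //.
have -> : e = L * (e / (L + 1)) + e / (L + 1) by field; rewrite gt_eqF.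
by rewrite lerD // (le_trans (lip _ _ _ _)) // ler_wpM2l.
Qed.

Lemma half_half : sc 2^-1 + sc 2^-1 = 1.
Proof. by rewrite -rmorphD -[RHS](rmorph1 sc); congr sc; field. Qed.

(** With [x = 1 - h], the root is [1 - y] where [y = (x + y^2) / 2]. The iteration is majorised by
    [t = (1 + t^2) / 2], whose iterates from 0 stay below the fixed point 1; this covers the
    boundary case [nrm x = 1], where no strict contraction is available. *)
Lemma sqrt_near_one h : star h = h -> nrm (1 - h) <= 1 ->
  exists k, [/\ star k = k, nrm (1 - k) <= 1 & h = k * k].
Proof.
move=> sh h1; set x := 1 - h in h1 *.
pose phi a := sc 2^-1 * (x + a * a).
pose psi t : R := 2^-1 * (1 + t * t).
have phiB a b : phi a - phi b = sc 2^-1 * ((a + b) * (a - b)) by rewrite /phi; ring.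
have nphi a b s t : nrm (a + b) <= s + t -> nrm (a - b) <= s - t ->
    nrm (phi a - phi b) <= psi s - psi t.
  move=> ab1 ab2; rewrite phiB nrmZ ger0_norm ?invr_ge0 ?ler0n //.
  have -> : psi s - psi t = 2^-1 * ((s + t) * (s - t)) by rewrite /psi; ring.
  rewrite ler_wpM2l ?invr_ge0 ?ler0n // (le_trans (nrmM _ _)) //.
  by rewrite ler_pM ?nrm_ge0.
have psi01 n : 0 <= iter n psi 0 <= 1.
  elim: n => [|n /andP[p0 p1]]; first by rewrite lexx ler01.
  by rewrite /= /psi; apply/andP; split; nra.
(* Sizes and increments are bounded together, since [phi a - phi b] is half of
   [(a + b) * (a - b)]. *)
have dom n : nrm (iter n phi 0) <= iter n psi 0 /\
    nrm (iter n.+1 phi 0 - iter n phi 0) <= iter n.+1 psi 0 - iter n psi 0.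
  elim: n => [|n [IH1 IH2]].
    rewrite /= nrm0 subr0 subr0; split=> //.
    rewrite /phi /psi !mul0r !addr0 mulr1 nrmZ ger0_norm ?invr_ge0 ?ler0n //.
    by rewrite -[leRHS]mulr1 ler_wpM2l ?invr_ge0 ?ler0n.
  have IH3 : nrm (iter n.+1 phi 0) <= iter n.+1 psi 0.
    by rewrite -[X in nrm X](subrK (iter n phi 0)) (le_trans (nrmD _ _)) //
       -[leRHS](subrK (iter n psi 0)) lerD.
  split=> //; apply: (nphi _ _ _ _ _ IH2).
  by rewrite (le_trans (nrmD _ _)) // lerD.
have [||a b a1 b1|a sa|y [y1 sy ey]] := @dominated_fixpoint phi psi 1 1 _ (fun n => (dom n).2).
- exact: ler01.
- by move=> n; case/andP: (psi01 n).
- rewrite phiB nrmZ ger0_norm ?invr_ge0 ?ler0n // mul1r.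
  have := nrmM (a + b) (a - b); have := nrmD a b; have := nrm_ge0 (a - b).
  move: (nrm (_ * _)) (nrm (_ + _)) (nrm (_ - _)) => u v w *.
  have : v * w <= 2 * w by rewrite ler_wpM2r //; lra.
  by lra.
- by rewrite /phi starM star_sc starD starM sa /x starB star1 sh.
exists (1 - y); split; first by rewrite starB star1 sy.
  by rewrite opprB addrC subrK.
have : sc 2^-1 * (x + y * y) + sc 2^-1 * (x + y * y) = y + y by rewrite -[X in _ = X + X]ey.
rewrite -mulrDl half_half mul1r /x => e.
have -> : h = 1 + y * y - (1 - h + y * y) by ring.
by rewrite e; ring.
Qed.

(** The inverse is the fixed point of [a => 1 + x * a], majorised by the partial sums of the
    geometric series [(1 - t)^-1]. *)
Lemma neumann x t : star x = x -> nrm x <= t -> t < 1 ->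
  exists y, star y = y /\ (1 - x) * y = 1.
Proof.
move=> sx xt t1; have t0 : 0 <= t by apply: le_trans xt; apply: nrm_ge0.
pose phi a := 1 + x * a; pose psi s : R := 1 + t * s.
have phiB a b : phi a - phi b = x * (a - b) by rewrite /phi; ring.
have [||n|a b _ _|a sa|y [_ sy ey]] := @dominated_fixpoint phi psi 1 (1 - t)^-1.
- exact: ler01.
- elim=> [|n IH].
    by rewrite /= /phi /psi !mulr0 !addr0 !subr0 nrm1_le1.
  have -> : iter n.+2 psi 0 - iter n.+1 psi 0 = t * (iter n.+1 psi 0 - iter n psi 0).
    by rewrite /= /psi; ring.
  rewrite -[X in nrm X]/(phi (iter n.+1 phi 0) - phi (iter n phi 0)) phiB.
  by rewrite (le_trans (nrmM _ _)) // ler_pM ?nrm_ge0.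
- elim: n => [|n IH]; first by rewrite /= invr_ge0 subr_ge0 ltW.
  have -> : (1 - t)^-1 = 1 + t * (1 - t)^-1 by field; rewrite subr_eq0 gt_eqF.
  by rewrite lerD2l ler_wpM2l.
- rewrite phiB mul1r (le_trans (nrmM _ _)) // ler_piMl ?nrm_ge0 //.
  by apply: le_trans xt _; apply: ltW.
- by rewrite /phi starD star1 starM sx sa.
by exists y; split=> //; rewrite mulrBl mul1r -{1}ey /phi addrK.
Qed.

End CStar.

(** * The positive cone *)

Section Cone.
Context (R : realType) (A : comCStarAlgType R).
Local Notation B := (cring A).
Implicit Types (a b c h k x y : B) (s t : R).
Local Notation sc := (@sc R A).
Local Notation im1 := (@im1 R A).

(** Squares of self-adjoint elements make products of positive elements visibly positive; [cleP]
    identifies this cone with that of the elements [c^* c]. *)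
Definition pos (h : B) : Prop := exists2 k, star k = k & h = k * k.

Lemma pos_sa h : pos h -> star h = h.
Proof. by case=> k sk ->; rewrite starM sk. Qed.

Lemma pos_sq k : star k = k -> pos (k * k). Proof. by exists k. Qed.

Lemma pos0 : pos 0. Proof. by rewrite -[0](mul0r 0); apply/pos_sq/star0. Qed.

Lemma pos1 : pos 1. Proof. by rewrite -[1](mul1r 1); apply/pos_sq/star1. Qed.

Lemma pos_sc t : 0 <= t -> pos (sc t).
Proof.
move=> t0; exists (sc (Num.sqrt t)); first exact: star_sc.
by rewrite -rmorphM -expr2 sqr_sqrtr.
Qed.

Lemma posM h k : pos h -> pos k -> pos (h * k).
Proof.
move=> [u su ->] [v sv ->]; exists (u * v); first by rewrite starM su sv.
by rewrite mulrACA.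
Qed.

Lemma star_sc_mul t a : star a = a -> star (sc t * a) = sc t * a.
Proof. by move=> sa; rewrite starM star_sc sa. Qed.

Lemma nrm_im1 : nrm im1 <= 1.
Proof.
have := nrm_starM im1; rewrite star_im1 mulNr im1M opprK => e.
by rewrite -(@expr_le1 _ 2) ?nrm_ge0 // -e nrm1_le1.
Qed.

(* [a + i sqrt(1 - a^2)] is unitary, so its imaginary part has norm at most 1. *)
Lemma nrm_one_sub_sq a : star a = a -> nrm a <= 1 -> nrm (1 - a * a) <= 1.
Proof.
move=> sa a1.
have [||k [sk _ ek]] := @sqrt_near_one R A (1 - a * a).
- by rewrite starB star1 starM sa.
- by rewrite subKr nrm_sq // expr_le1 // nrm_ge0.
pose u := a + im1 * k.
have su : star u = a - im1 * k by rewrite /u starD starM star_im1 sa sk mulNr.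
have uu : star u * u = 1.
  have -> : star u * u = a * a - (im1 * im1) * (k * k) by rewrite su /u; ring.
  by rewrite im1M -ek; ring.
have u1 : nrm u <= 1.
  by rewrite -(@expr_le1 _ 2) ?nrm_ge0 // -nrm_starM uu nrm1_le1.
have -> : 1 - a * a = k * k by [].
have kE : k = sc 2^-1 * (- im1 * (u - star u)).
  have -> : - im1 * (u - star u) = - (im1 * im1) * (k + k) by rewrite su /u; ring.
  by rewrite im1M opprK mul1r mulrDr -mulrDl half_half mul1r.
have k1 : nrm k <= 1.
  rewrite kE nrmZ ger0_norm ?invr_ge0 ?ler0n //.
  have := nrmM (- im1) (u - star u); rewrite nrmN.
  have := nrmB u (star u); rewrite nrm_star => v2 wle.
  have h1 := nrm_im1.
  have : nrm im1 * nrm (u - star u) <= 1 * 2 by apply: ler_pM; rewrite ?nrm_ge0 //; lra.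
  by move: wle; clear; lra.
by rewrite nrm_sq // expr_le1 // nrm_ge0.
Qed.

(** [sqrt_near_one] rescaled by [t]. The norm bound on [k] has the same form as the hypothesis on
    [h], so that [k] is itself positive by [pos_of_nrm]. *)
Lemma sqrt_near_scalar h t : star h = h -> nrm (sc t - h) <= t ->
  exists k, [/\ star k = k, nrm (sc (Num.sqrt t) - k) <= Num.sqrt t & h = k * k].
Proof.
move=> sh ht; have t0 := le_trans (nrm_ge0 _) ht.
have [t00|tn0] := eqVneq t 0.
  exists 0; split; rewrite ?star0 ?subr0 ?nrm_sc ?sqrtr_ge0 ?mulr0 //.
  apply/eqP; rewrite -oppr_eq0; apply/eqP/nrm0_eq0/le_anti; rewrite nrm_ge0.
  by move: ht; rewrite t00 rmorph0 sub0r => ->.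
have tp : 0 < t by rewrite lt0r tn0.
have st : Num.sqrt t * Num.sqrt t = t by rewrite -expr2 sqr_sqrtr.
have [||k [sk k1 ek]] := @sqrt_near_one R A (sc t^-1 * h).
- exact: star_sc_mul.
- have -> : 1 - sc t^-1 * h = sc t^-1 * (sc t - h).
    by rewrite mulrBr -rmorphM mulVf // rmorph1.
  by rewrite nrmZ ger0_norm ?invr_ge0 // mulrC ler_pdivrMr // mul1r.
exists (sc (Num.sqrt t) * k); split; first exact: star_sc_mul.
  rewrite -[X in X - _]mulr1 -mulrBr nrmZ ger0_norm ?sqrtr_ge0 //.
  by rewrite ler_piMr // sqrtr_ge0.
by rewrite mulrACA -rmorphM st -ek mulrA -rmorphM mulfV // rmorph1 mul1r.
Qed.

Lemma pos_of_nrm h t : star h = h -> nrm (sc t - h) <= t -> pos h.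
Proof. by move=> sh /(sqrt_near_scalar sh)[k [sk _ ->]]; exists k. Qed.

(** Converse of [pos_of_nrm]: dividing the root [k] by [sqrt t] brings its norm below 1, and
    [nrm_one_sub_sq] applies. *)
Lemma nrm_of_pos h t : pos h -> nrm h <= t -> nrm (sc t - h) <= t.
Proof.
move=> [k sk ->] kt; have t0 := le_trans (nrm_ge0 _) kt.
have [t00|tn0] := eqVneq t 0.
  by move: kt; rewrite t00 rmorph0 sub0r nrmN.
have tp : 0 < t by rewrite lt0r tn0.
pose r := Num.sqrt t; have rp : 0 < r by rewrite sqrtr_gt0.
have rr : r * r = t by rewrite -expr2 sqr_sqrtr.
have -> : sc t - k * k = sc t * (1 - (sc r^-1 * k) * (sc r^-1 * k)).
  have -> : (sc r^-1 * k) * (sc r^-1 * k) = sc t^-1 * (k * k).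
    by rewrite mulrACA -rmorphM -invfM rr.
  by rewrite mulrBr mulr1 [sc t * (_ * _)]mulrA -rmorphM mulfV // rmorph1 mul1r.
rewrite nrmZ ger0_norm // ler_piMr //; apply: nrm_one_sub_sq.
  exact: star_sc_mul.
rewrite nrmZ ger0_norm ?invr_ge0 ?(ltW rp) // mulrC ler_pdivrMr // mul1r.
by rewrite -(@ler_pXn2r _ 2) ?nnegrE ?nrm_ge0 ?(ltW rp) // -nrm_sq // expr2 rr.
Qed.

(** The norm criterion is stable under sums by the triangle inequality. *)
Lemma posD h k : pos h -> pos k -> pos (h + k).
Proof.
move=> ph pk; apply: (@pos_of_nrm _ (nrm h + nrm k)).
  by rewrite starD !pos_sa.
have -> : sc (nrm h + nrm k) - (h + k) = (sc (nrm h) - h) + (sc (nrm k) - k).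
  by rewrite rmorphD; ring.
by rewrite (le_trans (nrmD _ _)) // lerD // nrm_of_pos.
Qed.

Lemma pos_sum (I : Type) (r : seq I) (P : pred I) (f : I -> B) :
  (forall i, P i -> pos (f i)) -> pos (\sum_(i <- r | P i) f i).
Proof. by move=> pf; elim/big_rec: _ => [|i x Pi]; [exact: pos0|apply/posD/pf]. Qed.

Lemma pos_sqrt h : pos h -> exists2 k, pos k & k * k = h.
Proof.
move=> ph; have [k [sk nk ->]] := sqrt_near_scalar (pos_sa ph) (nrm_of_pos ph (lexx _)).
by exists k => //; apply: pos_of_nrm nk.
Qed.

Lemma re_im c : exists a b, [/\ star a = a, star b = b & c = a + im1 * b].
Proof.
exists (sc 2^-1 * (c + star c)), (sc 2^-1 * (- im1 * (c - star c))).
split; rewrite ?starM ?star_sc ?starN ?star_im1 ?starD ?starN ?starK.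
- by rewrite addrC.
- by ring.
have -> : sc 2^-1 * (c + star c) + im1 * (sc 2^-1 * (- im1 * (c - star c))) =
  sc 2^-1 * (c + star c) - (im1 * im1) * (sc 2^-1 * (c - star c)) by ring.
rewrite im1M.
have -> : sc 2^-1 * (c + star c) - -1 * (sc 2^-1 * (c - star c)) =
  (sc 2^-1 + sc 2^-1) * c by ring.
by rewrite half_half mul1r.
Qed.

Lemma starM_re_im a b : star a = a -> star b = b ->
  star (a + im1 * b) * (a + im1 * b) = a * a + b * b.
Proof.
move=> sa sb; rewrite starD starM star_im1 sa sb.
have -> : (a + - im1 * b) * (a + im1 * b) = a * a - (im1 * im1) * (b * b) by ring.
by rewrite im1M mulN1r opprK.
Qed.

Lemma starM_eq0 c : star c * c = 0 -> c = 0.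
Proof.
move=> /(congr1 (@nrm R A)); rewrite nrm_starM nrm0 => /eqP.
by rewrite sqrf_eq0 => /eqP/nrm0_eq0.
Qed.

(** For [c = a + i b] with [a], [b] self-adjoint, commutativity gives [c^* c = a^2 + b^2]. *)
Lemma pos_starM c : pos (star c * c).
Proof. by have [a [b [sa sb ->]]] := re_im c; rewrite starM_re_im //; apply/posD; apply/pos_sq. Qed.

Lemma cleP (a b : B) : cle (a : A) b <-> pos (b - a).
Proof.
split=> [[c e]|[k sk e]]; last by exists (k : A); rewrite -[cstar _]/(star k) sk.
by rewrite (_ : b - a = star c * c) //; apply: pos_starM.
Qed.

(** If [h = k^2] and [- h = l^2], then [u = k + i l] has [u^* u = k^2 + l^2 = 0]; so [u] and its
    adjoint vanish, and with them [k]. *)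
Lemma pos_anti h : pos h -> pos (- h) -> h = 0.
Proof.
move=> [k sk ->] [l sl kl].
have u0 : k + im1 * l = 0.
  by apply: starM_eq0; rewrite starM_re_im // -kl subrr.
have v0 : k - im1 * l = 0.
  by rewrite -{1}sk -{1}sl -mulNr -star_im1 -starM -starD u0 star0.
have -> : k = 0; last by rewrite mul0r.
rewrite -[k]mul1r -half_half mulrDl -mulrDr.
have -> : k + k = (k + im1 * l) + (k - im1 * l) by ring.
by rewrite u0 v0 addr0 mulr0.
Qed.

(** The positive elements [(h - k)^2 h] and [(h - k)^2 k] add up to [(h - k) (h^2 - k^2) = 0], so
    both vanish; hence [(h - k)^4 = 0]. *)
Lemma pos_sqrt_uniq h k : pos h -> pos k -> h * h = k * k -> h = k.
Proof.
move=> ph pk e; have sx : star (h - k) = h - k by rewrite starB !pos_sa.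
have hk : (h - k) * (h - k) * h = - ((h - k) * (h - k) * k).
  apply/eqP; rewrite -subr_eq0 opprK; apply/eqP.
  have -> : (h - k) * (h - k) * h + (h - k) * (h - k) * k =
    (h - k) * (h * h - k * k) by ring.
  by rewrite e subrr mulr0.
have p1 := posM (pos_sq sx) ph; have p2 := posM (pos_sq sx) pk.
have e1 : (h - k) * (h - k) * k = 0 by apply: pos_anti; rewrite // -hk.
have e2 : (h - k) * (h - k) * h = 0 by rewrite hk e1 oppr0.
apply/eqP; rewrite -subr_eq0; apply/eqP/sa_sqr_eq0 => //.
apply: sa_sqr_eq0; first by rewrite starM sx.
have -> : (h - k) * (h - k) * ((h - k) * (h - k)) =
  (h - k) * ((h - k) * (h - k) * h - (h - k) * (h - k) * k) by ring.
by rewrite e1 e2 subrr mulr0.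
Qed.

Definition mod (a : B) : B := cmod (a : A).

Lemma modP a : pos (mod a) /\ mod a * mod a = star a * a.
Proof.
have [k pk ek] := pos_sqrt (pos_starM a).
(* The root [k] rules out the default value of [xget]. *)
rewrite /mod /cmod; case: xgetP => [b _ [/cleP]|/(_ k)[]].
  by rewrite subr0.
by split=> //; apply/cleP; rewrite subr0.
Qed.

Lemma mod_uniq a b : pos b -> b * b = star a * a -> mod a = b.
Proof. by have [pm em] := modP a => pb eb; apply: pos_sqrt_uniq; rewrite // em. Qed.

Lemma mod_pos a : pos a -> mod a = a.
Proof. by move=> pa; apply: mod_uniq; rewrite // pos_sa. Qed.

(* With [p = |h| + h] and [q = |p|] one has [p^2 = 2|h|p], so [p^3] and [q^3]
   are positive with the same square, whence [p q^2 = q^3] and [p = q]. *)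
Lemma pos_modD h : star h = h -> pos (mod h + h).
Proof.
move=> sh; have [pm em] := modP h; rewrite sh in em.
set m := mod h in pm em *; set p := m + h.
have sp : star p = p by rewrite starD sh pos_sa.
have [pq eq] := modP p; rewrite sp in eq; set q := mod p in pq eq.
have p2 : p * p = (m + m) * p.
  have -> : (m + m) * p = p * p + (m * m - h * h) by rewrite /p; ring.
  by rewrite em subrr addr0.
have p3 : pos (p * (q * q)).
  rewrite eq (_ : p * (p * p) = (m + m) * (p * p)); last by rewrite [RHS]mulrA -p2; ring.
  by apply: posM; [exact: posD|exact: pos_sq].
have e3 : p * (q * q) = q * (q * q).
  apply: pos_sqrt_uniq => //; first by do 2?apply: posM.
  by rewrite mulrACA -eq -mulrACA.
have e2 : p * q = q * q.
  apply/eqP; rewrite -subr_eq0; apply/eqP/sa_sqr_eq0.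
    by rewrite starB !starM sp pos_sa.
  have -> : (p * q - q * q) * (p * q - q * q) =
     (p - q) * (p * (q * q) - q * (q * q)) by ring.
  by rewrite e3 subrr mulr0.
suff -> : p = q by [].
apply/eqP; rewrite -subr_eq0; apply/eqP/sa_sqr_eq0.
  by rewrite starB sp pos_sa.
have -> : (p - q) * (p - q) = p * p - (p * q + p * q) + q * q by ring.
by rewrite e2 -eq; ring.
Qed.

Lemma modN h : mod (- h) = mod h.
Proof.
by have [pm em] := modP h; apply: mod_uniq => //; rewrite starN mulrNN.
Qed.

Lemma pos_modB h : star h = h -> pos (mod h - h).
Proof. by move=> sh; rewrite -modN; apply: pos_modD; rewrite starN sh. Qed.

(** With [s = nrm (h - t)], the element [1 - h / (s + t)] has norm at most [s / (s + t) < 1], so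
    [neumann] inverts [h / (s + t)]. *)
Lemma pos_inv h t : 0 < t -> pos (h - sc t) -> exists2 k, pos k & h * k = 1.
Proof.
move=> t0 ph; set s := nrm (h - sc t).
have s0 : 0 <= s by apply: nrm_ge0.
have st0 : 0 < s + t by apply: ltr_wpDl.
have sh : star h = h.
  by rewrite -[h](subrK (sc t)) starD star_sc (pos_sa ph).
have pph : pos h by rewrite -[h](subrK (sc t)); apply/posD/pos_sc/ltW.
have nh := nrm_of_pos ph (lexx _); rewrite -/s in nh.
pose x := sc (s + t)^-1 * (sc (s + t) - h).
have xE : 1 - x = sc (s + t)^-1 * h.
  by rewrite /x mulrBr -rmorphM mulVf ?gt_eqF // rmorph1 subKr.
have [|||y [sy ey]] := @neumann R A x (s / (s + t)).
- by rewrite star_sc_mul // starB star_sc sh.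
- rewrite nrmZ ger0_norm ?invr_ge0 ?(ltW st0) // mulrC ler_pM2r ?invr_gt0 //.
  by rewrite rmorphD -addrA -[sc t - h]opprB.
- by rewrite ltr_pdivrMr // mul1r ltrDl.
exists (sc (s + t)^-1 * y); last by rewrite mulrCA mulrA -xE.
set k := _ * y; have hk : h * k = 1 by rewrite /k mulrCA mulrA -xE.
(* This form shows that the inverse is positive. *)
have -> : k = h * (k * k) by rewrite mulrA hk mul1r.
by apply: posM => //; apply: pos_sq; apply: star_sc_mul.
Qed.

End Cone.

(** * Bernstein weights *)

Section Order.
Context (R : realType) (A : comCStarAlgType R).
Local Notation B := (cring A).
Implicit Types (a b c h x v : B) (s t : R).
Local Notation sc := (@sc R A).
Local Notation "a <=c b" := (pos (b - a)) (at level 70).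

Lemma cle_trans b a c : a <=c b -> b <=c c -> a <=c c.
Proof. by move=> ab bc; rewrite -(subrKA b); apply: posD. Qed.

Lemma cleD a b c d : a <=c b -> c <=c d -> a + c <=c b + d.
Proof. by move=> ab cd; rewrite opprD addrACA; apply: posD. Qed.

Lemma cle_sc s t : s <= t -> sc s <=c sc t.
Proof. by move=> st; rewrite -rmorphB; apply: pos_sc; rewrite subr_ge0. Qed.

Lemma cle_sc_nrm h : pos h -> h <=c sc (nrm h).
Proof.
move=> ph; apply: (@pos_of_nrm _ _ _ (nrm h)); first by rewrite starB star_sc pos_sa.
by rewrite subKr.
Qed.

(* The mean of [f] under the binomial distribution with parameters [n] and [x]. *)
Fixpoint bernstein x (n : nat) (f : nat -> B) : B :=
  if n is m.+1 then (1 - x) * bernstein x m f + x * bernstein x m (f \o succn)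
  else f 0%N.

Lemma eq_bernstein x n f g : f =1 g -> bernstein x n f = bernstein x n g.
Proof.
elim: n f g => [|n IH] f g fg //=.
by rewrite (IH f g fg) (IH (f \o succn) (g \o succn)) // => k; apply: fg.
Qed.

Lemma bernstein_affine x n f a b :
  bernstein x n (fun k => a * f k + b) = a * bernstein x n f + b.
Proof. by elim: n f => [|n IH] f //=; rewrite IH (IH (f \o succn)); ring. Qed.

Lemma bernstein_pos x n f : pos x -> x <=c 1 ->
  (forall k, (k <= n)%N -> pos (f k)) -> pos (bernstein x n f).
Proof.
move=> x0 x1; elim: n f => [|n IH] f pf /=; first exact: pf.
by apply: posD; apply: posM => //; apply: IH => k kn; apply: pf; rewrite // leqW.
Qed.

Lemma bernstein_ge x n f v : pos x -> x <=c 1 ->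
  (forall k, (k <= n)%N -> v <=c f k) -> v <=c bernstein x n f.
Proof.
move=> x0 x1 vf.
rewrite (_ : bernstein x n f - v = bernstein x n (fun k => 1 * f k + - v)).
  by apply: bernstein_pos => // k /vf; rewrite mul1r.
by rewrite bernstein_affine mul1r.
Qed.

(** Squared mean plus binomial variance. The shift [c] is kept general because passing to
    [f \o succn] in the induction turns it into [1 + c]. *)
Lemma bernstein_sq x n c :
  bernstein x n (fun k => (k%:R + c) ^+ 2) =
  (n%:R * x + c) ^+ 2 + n%:R * (x * (1 - x)).
Proof.
elim: n c => [|n IH] c /=; first by ring.
rewrite IH (@eq_bernstein x n _ (fun k => (k%:R + (1 + c)) ^+ 2)); last first.
  by move=> k /=; rewrite -[k.+1]addn1 natrD addrA.
by rewrite IH -[n.+1]addn1 natrD; ring.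
Qed.

(** This is [(t - |h|)^2 >= 0] divided by [2 t]. It trades the modulus for a quadratic, whose
    Bernstein mean is known exactly. *)
Lemma mod_le_sq t h : 0 < t -> star h = h ->
  mod h <=c sc (2^-1 * t) + sc (2^-1 * t^-1) * h ^+ 2.
Proof.
move=> t0 sh; have [pm em] := modP h; rewrite sh in em.
rewrite (_ : _ - _ = sc (2^-1 * t^-1) * ((sc t - mod h) * (sc t - mod h))).
  apply: posM; first by apply: pos_sc; rewrite mulr_ge0 ?invr_ge0 ?(ltW t0).
  by apply: pos_sq; rewrite starB star_sc pos_sa.
have e1 : sc (2^-1 * t) = sc (2^-1 * t^-1) * (sc t * sc t).
  by rewrite -!rmorphM; congr sc; field; rewrite gt_eqF.
have e2 : sc (2^-1 * t^-1) * (sc t + sc t) = 1.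
  by rewrite -rmorphD -rmorphM -[RHS](rmorph1 sc); congr sc; field; rewrite gt_eqF.
by rewrite -[X in _ - X]mul1r -e2 e1 expr2 -em; ring.
Qed.

(* Averages the hypotheses with Bernstein weights: the variance of [k / n] about
   [x] is [x (1 - x) / n]. *)
Lemma le_of_le_grid x z v t n : pos x -> x <=c 1 -> pos z -> 0 < t ->
  t ^- 2 <= n.+1%:R ->
  (forall k, (k <= n.+1)%N -> v <=c mod (x - sc (k%:R / n.+1%:R)) * z) ->
  v <=c sc t * z.
Proof.
move=> x0 x1 z0 t0 tn vle; set N : R := n.+1%:R in tn vle.
have N0 : 0 < N by rewrite ltr0Sn.
have NE : n.+1%:R = sc N by rewrite rmorph_nat.
clearbody N; have sx : star x = x by apply: pos_sa.
(* Since [k - N x = - N (x - k / N)], these coefficients turn the bound of [mod_le_sq], multiplied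
   by [z], into [u (k - N x)^2 + w]. *)
pose u := z * sc (2^-1 * t^-1 * N ^- 2); pose w := z * sc (2^-1 * t).
apply: (@cle_trans (bernstein x n.+1 (fun k => u * (k%:R + - (n.+1%:R * x)) ^+ 2 + w))).
  apply: bernstein_ge => // k /vle /cle_trans; apply.
  set h := x - sc _.
  have hE : k%:R + - (n.+1%:R * x) = - (sc N * h).
    have <- : sc N * sc (k%:R / N) = k%:R.
      by rewrite -rmorphM mulrCA mulfV ?gt_eqF // mulr1 rmorph_nat.
    by rewrite NE /h; ring.
  have -> : u * (k%:R + - (n.+1%:R * x)) ^+ 2 + w =
      (sc (2^-1 * t) + sc (2^-1 * t^-1) * h ^+ 2) * z.
    have -> : sc (2^-1 * t^-1) = sc (2^-1 * t^-1 * N ^- 2) * (sc N * sc N).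
      by rewrite -!rmorphM; congr sc; field; rewrite !gt_eqF.
    by rewrite hE /u /w; ring.
  rewrite -mulrBl; apply: posM => //; apply: mod_le_sq => //.
  by rewrite /h starB star_sc sx.
rewrite bernstein_affine bernstein_sq subrr NE.
(* The mean is [z (t / 2 + q x (1 - x))]. The hypothesis on [N] says [q <= t / 2], and
   [1 - x (1 - x)] is the positive element [(1 - x) + x^2]. *)
set q := 2^-1 * t^-1 * N^-1.
have q0 : 0 <= q by rewrite !mulr_ge0 ?invr_ge0 ?(ltW t0) ?(ltW N0).
have -> : sc t * z - (u * (0 ^+ 2 + sc N * (x * (1 - x))) + w) =
    z * (sc (2^-1 * t - q) + sc q * ((1 - x) + x * x)).
  have -> : sc t = sc (2^-1 * t) + sc (2^-1 * t).
    by rewrite -rmorphD; congr sc; field.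
  have e : sc q = sc (2^-1 * t^-1 * N ^- 2) * sc N.
    by rewrite -rmorphM; congr sc; rewrite /q; field; rewrite !gt_eqF.
  have -> : sc (2^-1 * t - q) = sc (2^-1 * t) - sc q by rewrite rmorphB.
  by rewrite e /u /w; ring.
apply: posM => //; apply: posD.
  apply: pos_sc; rewrite subr_ge0 /q -mulrA ler_pM2l ?invr_gt0 //.
  by rewrite ler_pdivrMl // -expr2 -[leRHS]invrK lef_pV2 ?posrE ?invr_gt0 ?exprn_gt0.
apply: posM; first exact: pos_sc.
by apply: posD => //; apply: pos_sq.
Qed.

End Order.

(** * Lattice-normed modules *)

Section Module.
Context (R : realType) (A : stoneAlgType R) (E : latticeNormedModType A).
Local Notation B := (cring A).
Implicit Types (a b c h v : B) (s t : R) (x y z : E).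
Local Notation sc := (@sc R A).
Local Notation "a <=c b" := (pos (b - a)) (at level 70).

Definition lnm (x : E) : B := lnorm x.

Lemma lnm_pos x : pos (lnm x).
Proof. by have /cleP := lnorm_ge0 x; rewrite subr0. Qed.

Lemma lnmD x y : lnm (x + y) <=c lnm x + lnm y.
Proof. by apply/cleP; apply: ler_lnormD. Qed.

Lemma lnm0 : lnm 0 = 0.
Proof. by apply/lnorm_eq0. Qed.

Lemma lnmZ a x : lnm (a *: x) = mod a * lnm x.
Proof. exact: lnormZ. Qed.

(** The infimum is the supremum of the lower bounds; these are self-adjoint, because they differ
    from a self-adjoint element by a positive one. *)
Lemma cinf_ex (S : set A) : S !=set0 -> (forall a, S a -> cle 0 a) ->
  exists g, is_cinf S g.
Proof.
move=> [a0 Sa0] S0; have [|||g [g1 g2]] := @dedekind_complete R A (clower S).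
- move=> v /(_ _ Sa0)/cleP/pos_sa; have /cleP := S0 _ Sa0.
  rewrite subr0 => /pos_sa s0 ; rewrite starB s0 => /addrI/oppr_inj; exact.
- by exists 0.
- by exists a0 => v; apply.
by exists g; split=> [a Sa|v Sv]; [apply: g2 => v; apply|apply: g1].
Qed.

Lemma lnm_sum (I : Type) (r : seq I) (f : I -> E) :
  lnm (\sum_(i <- r) f i) <=c \sum_(i <- r) lnm (f i).
Proof.
elim: r => [|i r IH]; first by rewrite !big_nil lnm0 subr0; apply: pos0.
rewrite !big_cons; apply: cle_trans (lnmD _ _) _.
by apply: cleD IH; rewrite subrr; apply: pos0.
Qed.

(** Bounding every lower bound of the distances, rather than their infimum, lets Minkowski sums be
    treated without computing infima. *)
Definition order_precompact (N : set E) := forall t, 0 < t -> exists F : seq E,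
  forall x, N x -> forall v, (forall y, y \in F -> v <=c lnm (x - y)) -> v <=c sc t.

Lemma order_precompact1 y : order_precompact [set y].
Proof.
move=> t t0; exists [:: y] => _ -> v /(_ y); rewrite subrr lnm0 mem_head => /(_ isT) v0.
by apply: cle_trans v0 _; rewrite subr0; apply/pos_sc/ltW.
Qed.

(** The sums [y1 + y2] form the net. For fixed [y1], [v - |x1 - y1|] is below all [|x2 - y2|], hence
    below [t / 2]; so [v - t / 2] is below all [|x1 - y1|], hence below [t / 2] as well. *)
Lemma order_precompactD (N N1 N2 : set E) :
  order_precompact N1 -> order_precompact N2 ->
  (forall x, N x -> exists x1 x2, [/\ N1 x1, N2 x2 & x = x1 + x2]) ->
  order_precompact N.
Proof.
move=> c1 c2 sN t t0; have t2 : 0 < t / 2 by rewrite divr_gt0.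
have [F1 H1] := c1 _ t2; have [F2 H2] := c2 _ t2.
exists [seq y1 + y2 | y1 <- F1, y2 <- F2] => x /sN[x1 [x2 [N1x N2x ->]]] v vle.
have -> : sc t = sc (t / 2) + sc (t / 2) by rewrite -rmorphD -splitr.
rewrite -addrA [X in sc _ + X](_ : _ = - (v - sc (t / 2))); last by rewrite opprB.
apply: (H1 _ N1x) => y1 y1F.
rewrite (_ : _ - _ = sc (t / 2) - (v - lnm (x1 - y1))); last by ring.
apply: (H2 _ N2x) => y2 y2F.
rewrite (_ : _ - _ = lnm (x1 - y1) + lnm (x2 - y2) - v); last by ring.
apply: cle_trans (lnmD _ _); rewrite addrACA -opprD.
by apply: vle; apply/allpairsP; exists (y1, y2).
Qed.

Lemma order_precompact_segment z :
  order_precompact [set a *: z | a in [set a : B | pos a /\ a <=c 1]].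
Proof.
move=> t t0; set K := nrm (lnm z); have K0 : 0 <= K by apply: nrm_ge0.
have K1 : 0 < K + 1 by rewrite ltr_wpDl.
(* The grid yields [v <= s |z| <= s K <= t]; the added 1 allows [K = 0]. *)
set s := t / (K + 1); have s0 : 0 < s by rewrite divr_gt0.
pose n := Num.truncn (s ^- 2); have sn : s ^- 2 <= n.+1%:R by apply/ltW/truncnS_gt.
exists [seq sc (k%:R / n.+1%:R) *: z | k <- iota 0 n.+2] => _ [a [a0 a1] <-] v vle.
apply: (@cle_trans _ _ (sc s * lnm z)).
  apply: (le_of_le_grid a0 a1 (lnm_pos z) s0 sn) => k kn.
  rewrite -lnmZ scalerBl; apply: vle; apply/mapP; exists k => //.
  by rewrite mem_iota ltnS.
apply: (@cle_trans _ _ (sc (s * K))).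
  rewrite rmorphM -mulrBr; apply: posM; first exact/pos_sc/ltW.
  exact/cle_sc_nrm/lnm_pos.
apply: cle_sc; rewrite /s mulrAC ler_pdivrMr // ler_pM2l //; lra.
Qed.

End Module.

(** * Zonotopes and the two implications *)

Section Main.
Context (R : realType) (A : stoneAlgType R) (E : latticeNormedModType A).
Local Notation B := (cring A).
Implicit Types (a b c h v : B) (s t : R) (x y z : E).
Local Notation sc := (@sc R A).
Local Notation im1 := (@im1 R A).
Local Notation "a <=c b" := (pos (b - a)) (at level 70).

(** The real and imaginary parts lie between -1 and 1, and [d => (1 + d) / 2] carries them into the
    segment from 0 to 1. *)
Lemma contraction_re_im c : mod c <=c 1 -> exists a b,
  [/\ c = (a + a - 1) + im1 * (b + b - 1), pos a, a <=c 1, pos b & b <=c 1].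
Proof.
move=> c1; have [a [b [sa sb cE]]] := re_im c; have [pm em] := modP c.
(* Here [a^2 + b^2 = |c|^2], and [1 - |c|^2 = (1 - |c|) (1 + |c|)]. *)
have ab1 : pos (1 - (a * a + b * b)).
  rewrite -(starM_re_im sa sb) -cE -em.
  rewrite (_ : 1 - _ = (1 - mod c) * (1 + mod c)); last by ring.
  by apply: posM => //; apply: posD => //; apply: pos1.
(* [2 (1 - d) = (1 - d)^2 + (1 - d^2)] *)
have half d d' : star d = d -> star d' = d' -> pos (1 - (d * d + d' * d')) ->
    pos (sc 2^-1 * (1 - d)).
  move=> sd sd' dd'.
  have -> : sc 2^-1 * (1 - d) = sc 2^-1 * sc 2^-1 *
      ((1 - d) * (1 - d) + (1 - (d * d + d' * d')) + d' * d').
    rewrite -mulrA; congr (_ * _).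
    have -> : (1 - d) * (1 - d) + (1 - (d * d + d' * d')) + d' * d' =
      (1 - d) + (1 - d) by ring.
    by rewrite mulrDr -mulrDl half_half mul1r.
  have h0 : pos (sc 2^-1) by apply: pos_sc; rewrite invr_ge0 ler0n.
  apply: posM; first exact: posM.
  apply: posD; last exact: pos_sq.
  by apply: posD => //; apply: pos_sq; rewrite starB star1 sd.
have hh := @half_half R A.
exists (sc 2^-1 * (1 + a)), (sc 2^-1 * (1 + b)).
have E1 d : sc 2^-1 * (1 + d) + sc 2^-1 * (1 + d) - 1 = d.
  by rewrite -mulrDl hh mul1r addrAC subrr add0r.
have E2 d : 1 - sc 2^-1 * (1 + d) = sc 2^-1 * (1 - d).
  by rewrite -[X in X - _]hh; ring.
split; rewrite ?E1 ?E2 //.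
- by rewrite -[a]opprK; apply: (@half _ b); rewrite ?starN ?sa // mulrNN.
- by apply: (@half _ b).
- by rewrite -[b]opprK; apply: (@half _ a); rewrite ?starN ?sb // mulrNN [b * b + _]addrC.
- by apply: (@half _ a); rewrite // [b * b + _]addrC.
Qed.

(** A disc lies in the sum of two translated segments, in the directions [2 z] and [2 i z]. *)
Lemma order_precompact_disc z :
  order_precompact [set a *: z | a in [set a : B | mod a <=c 1]].
Proof.
have seg y : order_precompact [set x | exists2 a, pos a /\ a <=c 1 & x = (a + a - 1) *: y].
  apply: (order_precompactD (@order_precompact_segment _ _ _ ((1 + 1 : B) *: y))
                            (@order_precompact1 _ _ _ (- y))).
  move=> _ [a a01 ->]; exists (a *: ((1 + 1 : B) *: y)), (- y); split=> //.
    by exists a.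
  by rewrite scalerA mulrDr mulr1 scalerBl scale1r.
apply: (order_precompactD (seg z) (seg (im1 *: z))) => _ [c /= c1 <-].
have [a [b [-> a0 a1 b0 b1]]] := contraction_re_im c1.
exists ((a + a - 1) *: z), ((b + b - 1) *: (im1 *: z)); split.
- by exists a.
- by exists b.
- by rewrite scalerDl scalerA [im1 * _]mulrC.
Qed.

Lemma order_precompact_zonotope (r : seq E) :
  order_precompact [set x | exists2 l : E -> B,
    (forall y, y \in r -> mod (l y) <=c 1) & x = \sum_(y <- r) l y *: y].
Proof.
elim: r => [|z r IH].
  apply: (order_precompactD (@order_precompact1 _ _ _ 0) (@order_precompact1 _ _ _ 0)).
  by move=> _ [l _ ->]; exists 0, 0; rewrite big_nil addr0.
apply: (order_precompactD (@order_precompact_disc z) IH) => _ [l l1 ->].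
exists (l z *: z), (\sum_(y <- r) l y *: y); rewrite big_cons; split=> //.
  by exists (l z) => //=; apply: l1; rewrite mem_head.
by exists l => // y yr; apply: l1; rewrite in_cons yr orbT.
Qed.

Lemma propertyCP_totally_order_bounded (M : set E) :
  propertyCP M -> uniformly_totally_order_bounded M.
Proof.
move=> cp t t0; have t2 : 0 < t / 2 by rewrite divr_gt0.
have [F MF] := cp _ t2; have [G HG] := order_precompact_zonotope F t2.
(* Adjoining 0 makes the set of distances non-empty, so that its infimum exists. *)
exists [fset y in 0 :: G]%fset => x Mx.
have [z [l [[s [sup _] s1]] zE] [b bE xE]] := MF _ Mx.
have [||g [g1 g2]] := @cinf_ex _ _ [set lnorm (x - y) | y in [set` [fset y in 0 :: G]%fset]].
- by exists (lnorm (x - 0)), 0 => //=; rewrite !inE eqxx.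
- by move=> _ [y _ <-]; apply: lnorm_ge0.
exists g => //; apply/cleP.
have -> : (cscalar A t : B) = sc (t / 2) + sc (t / 2) by rewrite -rmorphD -splitr.
(* As [x = z + b] with [|b| <= t / 2], the element [g - t / 2] is below every [|z - y|], and the net
   [G] of the zonotope applies. *)
rewrite -addrA [X in sc _ + X](_ : _ = - ((g : B) - sc (t / 2))); last by rewrite opprB.
apply: (HG z) => [|y yG].
  exists l => // y yF.
  have /cleP ls : cle (cmod (l y)) s by apply: sup; right; exists y.
  by apply: cle_trans ls _; apply/cleP.
have gy : (g : B) <=c lnm (x - y).
  by apply/cleP/g1; exists y => //=; rewrite !inE yG orbT.
rewrite (_ : _ - _ = (lnm (z - y) + sc (t / 2)) - (g : B)); last by ring.
apply: cle_trans gy _; rewrite -xE [z + b - y]addrAC.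
apply: cle_trans (lnmD _ _) _; apply: cleD; first by rewrite subrr; apply: pos0.
by apply/cleP; apply: bE.
Qed.

Lemma totally_order_bounded_propertyCP (M : set E) :
  uniformly_totally_order_bounded M -> propertyCP M.
Proof.
move=> tb t t0; have t2 : 0 < t / 2 by rewrite divr_gt0.
have [F HF] := tb _ t2; exists F => x /HF[g [g1 g2] /cleP gt].
pose d y := sc t - lnm (x - y).
have sd y : star (d y) = d y by rewrite starB star_sc (pos_sa (lnm_pos _)).
pose p y := sc 2^-1 * (mod (d y) + d y).
have h0 : pos (sc 2^-1) by apply: pos_sc; rewrite invr_ge0 ler0n.
have p0 y : pos (p y) by apply: posM => //; apply: pos_modD.
have dp y : d y <=c p y.
  rewrite -[X in _ - X]mul1r -half_half (_ : _ - _ = sc 2^-1 * (mod (d y) - d y)); last first.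
    by rewrite /p; ring.
  by apply: posM => //; apply: pos_modB.
(* The weight [p y] lives where [|x - y| <= t]: from [d^2 = |d|^2] one gets
   [d (|d| + d) = |d| (|d| + d) >= 0]. *)
have pd y : lnm (x - y) * p y <=c sc t * p y.
  have [m0 mm] := modP (d y); rewrite sd in mm.
  rewrite -mulrBl -/(d y) (_ : d y * p y = sc 2^-1 * (mod (d y) * (mod (d y) + d y))).
    by apply: posM => //; apply: posM => //; apply: pos_modD.
  by rewrite [in RHS]mulrDr mm /p; ring.
pose S := \sum_(y <- F) p y.
have pS y : y \in F -> p y <=c S.
  move=> yF; rewrite /S (bigD1_seq y) ?fset_uniq //= addrC addrK.
  by apply: pos_sum => i _; apply: p0.
have St : pos (S - sc (t / 2)).
  have /g2/cleP lo : clower [set lnorm (x - y) | y in [set` F]] (sc t - S : B).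
    move=> _ [y yF <-]; apply/cleP.
    rewrite (_ : _ - _ = S - d y); last by rewrite /d -/(lnm _); ring.
    exact: cle_trans (dp y) (pS y yF).
  have := cle_trans lo gt; rewrite -[cscalar _ _]/(sc (t / 2)) {2}(splitr t) rmorphD.
  by rewrite (_ : _ - _ = S - sc (t / 2)) //; ring.
have [T T0 ST] := pos_inv t2 St.
pose l y := p y * T.
have l0 y : pos (l y) by apply: posM.
have l1 y : y \in F -> l y <=c 1.
  by move=> yF; rewrite -ST -mulrBl; apply: posM => //; apply: pS.
have sl : \sum_(y <- F) l y = 1 by rewrite -mulr_suml.
have upper1 : cupper (0 |` [set cmod (l y) | y in [set` F]]) (c1 : A).
  move=> _ [->|[y yF <-]]; apply/cleP; first by rewrite subr0; apply: pos1.
  by rewrite -[cmod _]/(mod _) mod_pos //; apply: l1.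
(* A zonotope asks for the supremum itself, not only for the upper bound 1. *)
have [|||s sup] := @dedekind_complete R A (0 |` [set cmod (l y) | y in [set` F]]).
- move=> _ [->|[y yF <-]]; first exact: (@star0 R A).
  by rewrite -[cmod _]/(mod _) mod_pos //; apply: pos_sa.
- by exists 0; left.
- by exists (c1 : A).
exists (\sum_(y <- F) l y *: y).
  by exists l; split=> //; exists s => //; apply: sup.2.
exists (x - \sum_(y <- F) l y *: y); last by rewrite addrC subrK.
(* The weights sum to 1; by [pd] each term then has norm at most [t * l y], and these bounds sum to
   [t]. *)
apply/cleP; have -> : x - \sum_(y <- F) l y *: y = \sum_(y <- F) l y *: (x - y).
  rewrite -[X in X - _]scale1r -sl scaler_suml -sumrB.
  by apply: eq_bigr => y _; rewrite scalerBr.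
apply: cle_trans (lnm_sum _ _) _.
rewrite -[cscalar _ _]/(sc t) -[sc t]mulr1 -sl mulr_sumr -sumrB.
apply: pos_sum => y _; rewrite lnmZ mod_pos //.
rewrite (_ : _ - _ = (sc t * p y - lnm (x - y) * p y) * T); last by rewrite /l; ring.
exact: posM.
Qed.

End Main.

Theorem proposition2p8 (R : realType) (A : stoneAlgType R)
    (E : latticeNormedModType A) (M : set E) :
  propertyCP M <-> uniformly_totally_order_bounded M.
Proof. by split; [exact: propertyCP_totally_order_bounded|exact: totally_order_bounded_propertyCP]. Qed.
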